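(* There exists a $2$-generator recursive presentation $Q$ such that the group $\overline{Q}$ it presents has $\mathrm{TorLen}(\overline{Q})=\infty$.
   Context: A recursive presentation is $\langle X\mid R\rangle$ with $X$ finite and $R$ a recursively enumerable set of words in $X^{\pm1}$. For a group $G$, define $\mathrm{Tor}_0(G)=\{e\}$ and inductively $\mathrm{Tor}_{i+1}(G)$ to be the normal closure in $G$ of $\{g\in G : g\,\mathrm{Tor}_i(G)\text{ has finite order in } G/\mathrm{Tor}_i(G)\}$; set $\mathrm{Tor}_\infty(G)=\bigcup_{i}\mathrm{Tor}_i(G)$. The torsion length $\mathrm{TorLen}(G)$ is the smallest $n\ge 0$ with $\mathrm{Tor}_n(G)=\mathrm{Tor}_\infty(G)$, and $\infty$ if no such $n$ exists. *)

(* Defs.v *)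
From Stdlib Require Import List Arith.
Import ListNotations.

(* A letter is (which generator, is-inverse): (false,_) = a, (true,_) = b;
   (_,false) = the generator, (_,true) = its inverse. *)
Definition letter : Type := (bool * bool)%type.
Definition word : Type := list letter.

Definition inv_letter (x : letter) : letter := (fst x, negb (snd x)).
Definition inv_word (w : word) : word := rev (map inv_letter w).

Fixpoint wpow (w : word) (n : nat) : word :=
  match n with 0 => [] | S n => w ++ wpow w n end.

(** A presentation <X | R> with X = {a,b} is given by R : word -> Prop. *)
Definition relators : Type := word -> Prop.

(** Equality in the presented group: the smallest equivalence relation on
    words containing the (context-closed) free cancellations x x^{-1} = 1
    and relator deletions r = 1 (r in R).  This is exactly the congruence
    whose quotient of the free monoid on X^{±1} is the group <X | R>. *)
Inductive geq (R : relators) : word -> word -> Prop :=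
| geq_refl w : geq R w w
| geq_sym w v : geq R w v -> geq R v w
| geq_trans w v u : geq R w v -> geq R v u -> geq R w u
| geq_cancel u v x : geq R (u ++ x :: inv_letter x :: v) (u ++ v)
| geq_rel u v r : R r -> geq R (u ++ r ++ v) (u ++ v).

(** Normal closure, in the group presented by R, of a set S of (words
    representing) group elements; as a set of words, closed under equality
    in the group. *)
Inductive ncl (R : relators) (S : word -> Prop) : word -> Prop :=
| ncl_one w : geq R w [] -> ncl R S w
| ncl_conj s u : S s -> ncl R S (u ++ s ++ inv_word u)
| ncl_conj_inv s u : S s -> ncl R S (u ++ inv_word s ++ inv_word u)
| ncl_mul w v : ncl R S w -> ncl R S v -> ncl R S (w ++ v)
| ncl_eq w v : geq R w v -> ncl R S w -> ncl R S v.

(** Tor_i of the presented group, as a set of words.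
    Tor_0 = {e};  Tor_{i+1} = normal closure of the g such that g Tor_i has
    finite order in G/Tor_i, i.e. g^n ∈ Tor_i for some n >= 1. *)
Fixpoint Tor (R : relators) (i : nat) : word -> Prop :=
  match i with
  | 0 => fun w => geq R w []
  | S i => ncl R (fun g => exists n, 0 < n /\ Tor R i (wpow g n))
  end.

Definition TorInf (R : relators) (w : word) : Prop := exists i, Tor R i w.

Definition TorLen_infinite (R : relators) : Prop :=
  forall n : nat, ~ (forall w, Tor R n w <-> TorInf R w).

Inductive rf : Type :=
| ZeroF | SuccF | ProjF (i : nat)
| CompF (f : rf) (gs : rfs)
| PrimF (f g : rf)
| MuF (f : rf)
with rfs : Type :=
| RNil | RCons (g : rf) (gs : rfs).

Inductive evalf : rf -> list nat -> nat -> Prop :=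
| ev_zero v : evalf ZeroF v 0
| ev_succ x v : evalf SuccF (x :: v) (S x)
| ev_proj i v : i < length v -> evalf (ProjF i) v (nth i v 0)
| ev_comp f gs v ys y : evals gs v ys -> evalf f ys y -> evalf (CompF f gs) v y
| ev_prim0 f g v y : evalf f v y -> evalf (PrimF f g) (0 :: v) y
| ev_primS f g n v y z :
    evalf (PrimF f g) (n :: v) y -> evalf g (n :: y :: v) z ->
    evalf (PrimF f g) (S n :: v) z
| ev_mu f v n :
    evalf f (n :: v) 0 ->
    (forall m, m < n -> exists k, evalf f (m :: v) (S k)) ->
    evalf (MuF f) v n
with evals : rfs -> list nat -> list nat -> Prop :=
| evs_nil v : evals RNil v []
| evs_cons g gs v y ys : evalf g v y -> evals gs v ys -> evals (RCons g gs) v (y :: ys).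

Definition re_nat (A : nat -> Prop) : Prop :=
  exists p : rf, forall x, A x <-> exists y, evalf p [x] y.

(** Injective, computable Gödel numbering of words (bijective base-5 style). *)
Definition code_letter (x : letter) : nat :=
  (if fst x then 2 else 0) + (if snd x then 1 else 0).
Fixpoint code_word (w : word) : nat :=
  match w with [] => 0 | x :: w => S (code_letter x) + 5 * code_word w end.

Definition re_words (R : relators) : Prop :=
  re_nat (fun k => exists w, R w /\ code_word w = k).

(* Main.v *)
From Stdlib Require Import List Arith ZArith Lia Bool.
Require Import Defs.
Import ListNotations.

(** The relators are arranged so that the group contains elements [x_n], [y_n] with
    [x_0^2 = y_0^2 = 1] and [x_(n+1)^2 = y_(n+1)^2 = y_n x_n^-1]; hence [x_n] lies in
    [Tor_(n+1)].  That it does not lie in [Tor_n] is read off an action.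

    Let [H] be the group of sequences of plane isometries
    [(u, v) |-> (e_i u + m_i, e_i e_(i+1) v + n_i)], [i >= 0], with signs [e_i] and integers
    [m_i], [n_i] such that [m_i] is odd iff [e_(i+1) = -1] and [n_i] is odd iff [e_i = -1]
    (each component lies in the wallpaper group pgg).  A torsion element of [H] is trivial in
    all components [i >= 1]: if [e_(i+1) = -1], then either [e_i = 1] and the first coordinate
    is translated by an odd number, or [e_i = -1] and the second one is.  Iterating, [Tor_n] is
    trivial in the components [i >= n], whereas [H] contains [x_n], [y_n] as above that act on
    component [n] by half-turns.

    Two generators suffice by the Neumann-Neumann embedding into [(H wr Z) wr Z]: torsion of a
    wreath product with [Z] lies in the base group, so it is torsion in each component.  The
    generator [b] is the outer shift; [a] is the inner shift at outer position [0], and at the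
    odd outer positions [s > 0] it is an [x_n] or [y_n] at all inner positions [t >= 0].  As
    differences of odd numbers are even, the commutator of [a] with its translate by [s] is
    concentrated at one place. *)

(** * The action *)

(* [outer] and [inner] are the positions in the two wreath products, [level] is the component
   [i], and [val] is the coordinate [u] ([axis = false]) or [v] ([axis = true]). *)
Record point := Point { outer : Z; inner : Z; level : nat; axis : bool; val : Z }.

Definition flip (e : bool) (z : Z) : Z := if e then (- z)%Z else z.

(* [x_n] for [y = false] and [y_n] for [y = true], or their inverses. *)
Definition gen_val (n : nat) (y inv : bool) (i : nat) (k : bool) (z : Z) : Z :=
  if Nat.eqb i n then
    if k then (1 - z)%Z else if y then (-2 - z)%Z else (- z)%Z
  else if Nat.eqb (S i) n then
    if k then (- z)%Z else if inv then (z - 1)%Z else (z + 1)%Z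
  else z.

(* Position [4 n + 1] carries [x_n] and position [4 n + 3] carries [y_n]. *)
Definition a_act (inv : bool) (p : point) : point :=
  let (j, t, i, k, z) := p in
  if Z.eqb j 0 then Point j (if inv then t - 1 else t + 1)%Z i k z
  else if (Z.ltb 0 j && Z.eqb (j mod 2) 1 && Z.leb 0 t)%bool then
    Point j t i k (gen_val (Z.to_nat (j / 4)) (Z.eqb (j mod 4) 3) inv i k z)
  else p.

Definition b_act (inv : bool) (p : point) : point :=
  let (j, t, i, k, z) := p in Point (if inv then j - 1 else j + 1)%Z t i k z.

Definition letter_act (x : letter) : point -> point :=
  if fst x then b_act (snd x) else a_act (snd x).

Definition act (w : word) (p : point) : point :=
  fold_left (fun q x => letter_act x q) w p.

Lemma act_app u v p : act (u ++ v) p = act v (act u p).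
Proof. apply fold_left_app. Qed.

Lemma gen_val_cancel n y inv i k z :
  gen_val n y (negb inv) i k (gen_val n y inv i k z) = z.
Proof.
  unfold gen_val.
  destruct (Nat.eqb i n), (Nat.eqb (S i) n), k, y, inv; cbn [negb xorb flip]; lia.
Qed.

Lemma letter_act_cancel x p : letter_act (inv_letter x) (letter_act x p) = p.
Proof.
  destruct x as [[|] inv], p as [j t i k z]; unfold letter_act; cbn [fst snd inv_letter].
  - unfold b_act; f_equal; destruct inv; cbn [negb]; lia.
  - unfold a_act.
    destruct (Z.eqb j 0) eqn:Ej.
    + rewrite Ej; f_equal; destruct inv; cbn [negb]; lia.
    + destruct (Z.ltb 0 j && Z.eqb (j mod 2) 1 && Z.leb 0 t)%bool eqn:E;
        rewrite Ej, E; [|reflexivity].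
      now rewrite gen_val_cancel.
Qed.

Lemma inv_letter_involutive x : inv_letter (inv_letter x) = x.
Proof. destruct x as [g i]; unfold inv_letter; cbn; now rewrite negb_involutive. Qed.

Lemma inv_word_app u v : inv_word (u ++ v) = inv_word v ++ inv_word u.
Proof. unfold inv_word; now rewrite map_app, rev_app_distr. Qed.

Lemma inv_word_cons x w : inv_word (x :: w) = inv_word w ++ [inv_letter x].
Proof. reflexivity. Qed.

Lemma inv_word_involutive w : inv_word (inv_word w) = w.
Proof.
  induction w as [|x w IH]; [reflexivity|].
  rewrite inv_word_cons, inv_word_app, IH; cbn.
  now rewrite inv_letter_involutive.
Qed.

Lemma inv_word_repeat x n : inv_word (repeat x n) = repeat (inv_letter x) n.
Proof.
  unfold inv_word; rewrite map_repeat; apply rev_repeat.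
Qed.

Lemma act_inv_word w p : act (inv_word w) (act w p) = p.
Proof.
  revert p; induction w as [|x w IH]; intro p; [reflexivity|].
  rewrite inv_word_cons, act_app.
  change (act (x :: w) p) with (act w (letter_act x p)).
  rewrite IH; apply letter_act_cancel.
Qed.

(** * Isometries with the parity constraints *)

Definition odd_iff (z : Z) (e : bool) : Prop := (z mod 2 = if e then 1 else 0)%Z.

(** Signs are booleans with [true] for -1, so [xorb] multiplies them. *)
Definition fiber_map (e : nat -> bool) (m n : nat -> Z) (i : nat) (k : bool) (z : Z) : Z :=
  if k then (flip (xorb (e i) (e (S i))) z + n i)%Z else (flip (e i) z + m i)%Z.

Definition parity_ok (e : nat -> bool) (m n : nat -> Z) : Prop :=
  forall i, odd_iff (m i) (e (S i)) /\ odd_iff (n i) (e i).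

Definition structured_at (f : point -> point) (j t j' t' : Z) : Prop :=
  exists e m n, parity_ok e m n /\
    forall i k z, f (Point j t i k z) = Point j' t' i k (fiber_map e m n i k z).

(** The shape of an element of the unrestricted (H wr Z) wr Z: one outer shift [s] for all points,
    and an inner shift that depends on the outer position only. *)
Definition structured (f : point -> point) : Prop :=
  exists s tau, forall j t, structured_at f j t (j + s) (t + tau j).

Lemma structured_at_id f j t j' t' :
  (forall i k z, f (Point j t i k z) = Point j' t' i k z) -> structured_at f j t j' t'.
Proof.
  intro H; exists (fun _ => false), (fun _ => 0%Z), (fun _ => 0%Z); split.
  - split; reflexivity.
  - intros; rewrite H; f_equal; unfold fiber_map; destruct k; cbn; lia.
Qed.

(** Modulo 2 a sign change does not affect the offsets, so offsets and sign exponents both add under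
    composition, and the parity constraints survive. *)
Lemma structured_comp f g :
  structured f -> structured g -> structured (fun p => g (f p)).
Proof.
  intros (s & tau & Hf) (s' & tau' & Hg).
  exists (s + s')%Z, (fun j => tau j + tau' (j + s))%Z; intros j t.
  destruct (Hf j t) as (e & m & n & P & E).
  destruct (Hg (j + s)%Z (t + tau j)%Z) as (e' & m' & n' & P' & E').
  exists (fun i => xorb (e i) (e' i)),
    (fun i => flip (e' i) (m i) + m' i)%Z,
    (fun i => flip (xorb (e' i) (e' (S i))) (n i) + n' i)%Z; split.
  - intro i; destruct (P i) as [P1 P2], (P' i) as [P1' P2']; unfold odd_iff in *.
    destruct (e i), (e' i), (e (S i)), (e' (S i)); cbn in *; split;
      Z.to_euclidean_division_equations; lia.
  - intros i k z; rewrite E, E'; f_equal; try lia.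
    unfold fiber_map.
    destruct k, (e i), (e' i), (e (S i)), (e' (S i)); cbn [xorb flip]; lia.
Qed.

(** Only the sign at level [n] is -1. This forces an odd second offset at level [n], where a
    half-turn results, and, for [n > 0], an odd first offset at level [n - 1], where a glide
    reflection results. *)
Lemma gen_val_fiber_map n y inv :
  exists e m l, parity_ok e m l /\
    forall i k z, gen_val n y inv i k z = fiber_map e m l i k z.
Proof.
  exists (fun i => Nat.eqb i n),
    (fun i => if Nat.eqb i n then if y then (-2)%Z else 0%Z
              else if Nat.eqb (S i) n then if inv then (-1)%Z else 1%Z else 0%Z),
    (fun i => if Nat.eqb i n then 1%Z else 0%Z).
  split.
  - intro i; unfold odd_iff.
    destruct (Nat.eqb_spec i n), (Nat.eqb_spec (S i) n); try lia;
      destruct y, inv; split; reflexivity.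
  - intros i k z; unfold gen_val, fiber_map.
    destruct (Nat.eqb_spec i n), (Nat.eqb_spec (S i) n); try lia;
      destruct k, y, inv; cbn [negb xorb flip]; lia.
Qed.

Lemma structured_letter x : structured (letter_act x).
Proof.
  destruct x as [[|] inv]; unfold letter_act; cbn [fst snd].
  - exists (if inv then -1 else 1)%Z, (fun _ => 0%Z); intros j t.
    apply structured_at_id; intros; unfold b_act; destruct inv; f_equal; lia.
  - exists 0%Z, (fun j => if Z.eqb j 0 then if inv then -1 else 1 else 0)%Z; intros j t.
    rewrite Z.add_0_r.
    destruct (Z.eqb j 0) eqn:Ej.
    { apply structured_at_id; intros; unfold a_act; rewrite Ej; destruct inv; f_equal; lia. }
    rewrite Z.add_0_r.
    destruct (Z.ltb 0 j && Z.eqb (j mod 2) 1 && Z.leb 0 t)%bool eqn:E.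
    + destruct (gen_val_fiber_map (Z.to_nat (j / 4)) (Z.eqb (j mod 4) 3) inv)
        as (e & m & l & P & H).
      exists e, m, l; split; [exact P|].
      intros; unfold a_act; rewrite Ej, E, H; reflexivity.
    + apply structured_at_id; intros; unfold a_act; now rewrite Ej, E.
Qed.

Lemma structured_act w : structured (act w).
Proof.
  induction w as [|x w IH].
  - exists 0%Z, (fun _ => 0%Z); intros; apply structured_at_id; intros; cbn; f_equal; lia.
  - exact (structured_comp _ _ (structured_letter x) IH).
Qed.

Lemma level_act w p : level (act w p) = level p.
Proof.
  destruct p as [j t i k z], (structured_act w) as (s & tau & H).
  destruct (H j t) as (e & m & n & _ & E); now rewrite E.
Qed.

(** * Torsion subgroups fix high levels *)

Definition fixes_from (n : nat) (w : word) : Prop :=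
  forall p, n <= level p -> act w p = p.

Lemma act_wpow_outer w s tau m p :
  (forall j t, structured_at (act w) j t (j + s) (t + tau j)) ->
  outer (act (wpow w m) p) = (outer p + Z.of_nat m * s)%Z.
Proof.
  intro H; revert p; induction m as [|m IH]; intro p; [cbn; lia|].
  cbn [wpow]; rewrite act_app, IH.
  destruct p as [j t i k z], (H j t) as (e & a & b & _ & E); rewrite E; cbn [outer]; lia.
Qed.

Lemma act_wpow_inner w tau m p :
  (forall j t, structured_at (act w) j t j (t + tau j)) ->
  inner (act (wpow w m) p) = (inner p + Z.of_nat m * tau (outer p))%Z.
Proof.
  intro H; revert p; induction m as [|m IH]; intro p; [cbn; lia|].
  cbn [wpow]; rewrite act_app, IH.
  destruct p as [j t i k z], (H j t) as (e & a & b & _ & E); rewrite E; cbn [outer inner]; lia.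
Qed.

Lemma act_wpow_translation w m j t i k c :
  (forall z, act w (Point j t i k z) = Point j t i k (z + c)) ->
  forall z, act (wpow w m) (Point j t i k z) = Point j t i k (z + Z.of_nat m * c).
Proof.
  intro H; induction m as [|m IH]; intro z; [cbn; f_equal; lia|].
  cbn [wpow]; rewrite act_app, H, IH; f_equal; lia.
Qed.

Lemma fixes_from_torsion n w m :
  0 < m -> fixes_from n (wpow w m) -> fixes_from (S n) w.
Proof.
  intros Hm Hfix.
  destruct (structured_act w) as (s & tau & H).
  assert (s = 0%Z) as ->.
  { pose proof (act_wpow_outer w s tau m (Point 0 0 n false 0) H) as E.
    rewrite Hfix in E by (cbn; lia); cbn [outer] in E; nia. }
  assert (H' : forall j t, structured_at (act w) j t j (t + tau j)).
  { intros j t; specialize (H j t); now rewrite Z.add_0_r in H. }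
  assert (Htau : forall j, tau j = 0%Z).
  { intro j; pose proof (act_wpow_inner w tau m (Point j 0 n false 0) H') as E.
    rewrite Hfix in E by (cbn; lia); cbn [outer inner] in E; nia. }
  intros [j t i k z] Hi; cbn [level] in Hi.
  destruct (H' j t) as (e & a & b & P & E); rewrite Htau, Z.add_0_r in E.
  assert (Hu : forall i, n <= i -> e i = false -> a i = 0%Z).
  { intros i0 Hi0 Hsgn.
    assert (T : forall z, act w (Point j t i0 false z) = Point j t i0 false (z + a i0)).
    { intro z0; rewrite E; unfold fiber_map; now rewrite Hsgn. }
    pose proof (act_wpow_translation w m _ _ _ _ _ T 0%Z) as F.
    rewrite Hfix in F by (cbn; lia); injection F; nia. }
  assert (Hv : forall i, n <= i -> xorb (e i) (e (S i)) = false -> b i = 0%Z).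
  { intros i0 Hi0 Hsgn.
    assert (T : forall z, act w (Point j t i0 true z) = Point j t i0 true (z + b i0)).
    { intro z0; rewrite E; unfold fiber_map; now rewrite Hsgn. }
    pose proof (act_wpow_translation w m _ _ _ _ _ T 0%Z) as F.
    rewrite Hfix in F by (cbn; lia); injection F; nia. }
  assert (He : forall i, n <= i -> e (S i) = false).
  { intros i0 Hi0; destruct (P i0) as [P1 P2]; unfold odd_iff in *.
    specialize (Hu i0 Hi0); specialize (Hv i0 Hi0).
    destruct (e (S i0)); [exfalso|reflexivity].
    destruct (e i0).
    - rewrite Hv in P2 by reflexivity; discriminate.
    - rewrite Hu in P1 by reflexivity; discriminate. }
  (* [He] makes the signs trivial strictly above level [n] only. At level [n] itself a half-turn
     remains possible, so the bound rises to [S n]. *)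
  destruct i as [|i]; [lia|].
  rewrite E; f_equal; unfold fiber_map.
  rewrite !He, Hu, Hv by (rewrite ?He; lia || reflexivity).
  destruct k; cbn; lia.
Qed.

Lemma geq_act R u v :
  (forall r, R r -> forall p, act r p = p) -> geq R u v -> forall p, act u p = act v p.
Proof.
  intros HR; induction 1 as [w|w v _ IH|w v u _ IH1 _ IH2|u v x|u v r Hr]; intro p.
  - reflexivity.
  - now rewrite IH.
  - now rewrite IH1.
  - rewrite !act_app.
    change (act (x :: inv_letter x :: v) (act u p))
      with (act v (letter_act (inv_letter x) (letter_act x (act u p)))).
    now rewrite letter_act_cancel.
  - now rewrite !act_app, (HR r Hr).
Qed.

Lemma fixes_from_inv n w : fixes_from n w -> fixes_from n (inv_word w).
Proof. intros H p Hp; rewrite <- (H p Hp) at 1; apply act_inv_word. Qed.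

(** Words preserve levels, so the conjugator keeps the point where [w] acts trivially. *)
Lemma fixes_from_conj n u w : fixes_from n w -> fixes_from n (u ++ w ++ inv_word u).
Proof.
  intros H p Hp; rewrite !act_app, (H (act u p)); [apply act_inv_word|now rewrite level_act].
Qed.

Lemma Tor_fixes_from R n w :
  (forall r, R r -> forall p, act r p = p) -> Tor R n w -> fixes_from n w.
Proof.
  intro HR; revert w; induction n as [|n IH]; intro w.
  - intros H p _; exact (geq_act R w [] HR H p).
  - cbn [Tor]; induction 1 as [w H|s u [m [Hm Hs]]|s u [m [Hm Hs]]|w v _ H1 _ H2|w v H _ H'].
    + intros p _; exact (geq_act R w [] HR H p).
    + apply fixes_from_conj; eauto using fixes_from_torsion.
    + apply fixes_from_conj, fixes_from_inv; eauto using fixes_from_torsion.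
    + intros p Hp; now rewrite act_app, H1, H2.
    + intros p Hp; rewrite <- (geq_act R w v HR H); auto.
Qed.

(** * The relators *)

Definition la : letter := (false, false).
Definition lA : letter := (false, true).
Definition lb : letter := (true, false).
Definition lB : letter := (true, true).

Definition position (n : nat) (y : bool) : nat := 4 * n + (if y then 3 else 1).

(* [x_n] for [y = false] and [y_n] for [y = true]. *)
Definition gen_word (n : nat) (y : bool) : word :=
  let s := position n y in
  [la] ++ repeat lb s ++ [la] ++ repeat lB s ++ [lA] ++ repeat lb s ++ [lA] ++ repeat lB s.

(** Encodes x_(n+1)^2 = y_n x_n^-1, or y_(n+1)^2 = y_n x_n^-1 if [y] is [true]. *)
Definition square_relator (n : nat) (y : bool) : word :=
  gen_word (S n) y ++ gen_word (S n) y ++ gen_word n false ++ inv_word (gen_word n true).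

Definition tower (w : word) : Prop :=
  (exists y, w = gen_word 0 y ++ gen_word 0 y) \/ (exists n y, w = square_relator n y).

Lemma act_repeat_lb s j t i k z :
  act (repeat lb s) (Point j t i k z) = Point (j + Z.of_nat s) t i k z.
Proof.
  revert j; induction s as [|s IH]; intro j; [cbn; f_equal; lia|].
  change (act (repeat lb (S s)) (Point j t i k z))
    with (act (repeat lb s) (Point (j + 1) t i k z)).
  rewrite IH; f_equal; lia.
Qed.

Lemma act_repeat_lB s j t i k z :
  act (repeat lB s) (Point j t i k z) = Point (j - Z.of_nat s) t i k z.
Proof.
  revert j; induction s as [|s IH]; intro j; [cbn; f_equal; lia|].
  change (act (repeat lB (S s)) (Point j t i k z))
    with (act (repeat lB s) (Point (j - 1) t i k z)).
  rewrite IH; f_equal; lia.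
Qed.

Lemma act_gen_word n y j t i k z :
  act (gen_word n y) (Point j t i k z) =
  Point j t i k (if (Z.eqb j 0 && Z.eqb t (-1))%bool then gen_val n y false i k z else z).
Proof.
  unfold gen_word; set (s := position n y).
  rewrite !act_app.
  change (act [la]) with (a_act false); change (act [lA]) with (a_act true).
  assert (Hs : (Z.of_nat s mod 2 = 1 /\ Z.of_nat s / 4 = Z.of_nat n /\
                Z.eqb (Z.of_nat s mod 4) 3 = y /\ 0 < Z.of_nat s)%Z).
  { unfold s, position; destruct y; repeat split;
      try (apply Z.eqb_eq); try (apply Z.eqb_neq); Z.to_euclidean_division_equations; lia. }
  destruct Hs as (Hs1 & Hs2 & Hs3 & Hs4).
  destruct (Z.eqb_spec j 0) as [->|Hj].
  - assert (F : forall inv t i k z, a_act inv (Point (0 + Z.of_nat s) t i k z) =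
        Point (0 + Z.of_nat s) t i k (if Z.leb 0 t then gen_val n y inv i k z else z)).
    { intros inv t0 i0 k0 z0; unfold a_act; rewrite Z.add_0_l.
      destruct (Z.eqb_spec (Z.of_nat s) 0); [lia|].
      destruct (Z.ltb_spec 0 (Z.of_nat s)); [|lia].
      rewrite Hs1, Hs2, Hs3, Nat2Z.id; cbn [Z.eqb Pos.eqb andb].
      destruct (Z.leb 0 t0); reflexivity. }
    assert (F0 : forall (inv : bool) t i k z,
        a_act inv (Point 0 t i k z) = Point 0 (if inv then t - 1 else t + 1)%Z i k z)
      by reflexivity.
    rewrite F0, act_repeat_lb, F, act_repeat_lB, Z.add_simpl_r, F0.
    rewrite act_repeat_lb, F, act_repeat_lB, Z.add_simpl_r.
    rewrite Z.add_simpl_r; f_equal; cbn [andb].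
    (* Between the two inner shifts the generator is applied when [t + 1 >= 0], after them its
       inverse when [t >= 0]; the two cancel except at [t = -1]. *)
    destruct (Z.leb_spec 0 t), (Z.leb_spec 0 (t + 1)), (Z.eqb_spec t (-1)); try lia.
    apply (gen_val_cancel n y false).
  (* Away from [j = 0] one of the two commutator factors acts trivially: the first unless [j] is
     positive and odd, and then the second, because [s] is odd and [j + s] is even and positive. *)
  - assert (C : (forall inv t i k z, a_act inv (Point j t i k z) = Point j t i k z) \/
        (forall inv t i k z, a_act inv (Point (j + Z.of_nat s) t i k z)
                             = Point (j + Z.of_nat s) t i k z)).
    { unfold a_act.
      destruct (Z.eqb_spec j 0) as [|_]; [lia|].
      destruct (Z.ltb_spec 0 j); [|left; reflexivity].
      destruct (Z.eqb_spec (j mod 2) 1); [right|left; reflexivity].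
      intros.
      destruct (Z.eqb_spec (j + Z.of_nat s) 0); [lia|].
      destruct (Z.ltb_spec 0 (j + Z.of_nat s)); [|reflexivity].
      destruct (Z.eqb_spec ((j + Z.of_nat s) mod 2) 1); [|reflexivity].
      Z.to_euclidean_division_equations; lia. }
    assert (K : forall inv p, a_act (negb inv) (a_act inv p) = p)
      by (intros inv p; exact (letter_act_cancel (false, inv) p)).
    assert (D : forall inv j t i k z, exists t' z',
        a_act inv (Point j t i k z) = Point j t' i k z').
    { intros inv j0 t0 i0 k0 z0; unfold a_act; destruct (Z.eqb j0 0); [eauto|].
      destruct (Z.ltb 0 j0 && Z.eqb (j0 mod 2) 1 && Z.leb 0 t0)%bool; eauto. }
    cbn [andb].
    destruct C as [C|C].
    + rewrite C, act_repeat_lb.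
      destruct (D false (j + Z.of_nat s)%Z t i k z) as (t' & z' & E); rewrite E.
      rewrite act_repeat_lB, Z.add_simpl_r, C, act_repeat_lb, <- E, (K false).
      now rewrite act_repeat_lB, Z.add_simpl_r.
    + destruct (D false j t i k z) as (t' & z' & E); rewrite E.
      rewrite act_repeat_lb, C, act_repeat_lB, Z.add_simpl_r, <- E, (K false).
      now rewrite act_repeat_lb, C, act_repeat_lB, Z.add_simpl_r.
Qed.

Lemma act_inv_gen_word n y j t i k z :
  act (inv_word (gen_word n y)) (Point j t i k z) =
  Point j t i k (if (Z.eqb j 0 && Z.eqb t (-1))%bool then gen_val n y true i k z else z).
Proof.
  (* Writing the right-hand side as the inverse word applied to its image reduces the claim to
     [act_gen_word]. *)
  rewrite <- (act_inv_word (gen_word n y) (Point j t i k (if _ : bool then _ else z))).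
  f_equal; rewrite act_gen_word; f_equal.
  destruct (_ && _)%bool; [|reflexivity].
  symmetry; apply (gen_val_cancel n y true).
Qed.

(** x_0 and y_0 act by half-turns only. In [square_relator n y], a half-turn is squared at level
    [n + 1]; at level [n] the squared glide reflection translates u by 2 and the two half-turns undo
    this; at level [n - 1] the glide reflections of x_n and y_n^-1 cancel. *)
Lemma tower_act r : tower r -> forall p, act r p = p.
Proof.
  intros [[y ->]|(n & y & ->)] [j t i k z]; unfold square_relator;
    rewrite !act_app, !act_gen_word, ?act_inv_gen_word; f_equal;
    destruct (_ && _)%bool; try reflexivity; unfold gen_val.
  - destruct (Nat.eqb_spec i 0), y, k; cbn [Nat.eqb]; lia.
  - destruct (Nat.eqb_spec i n), (Nat.eqb_spec i (S n)), (Nat.eqb_spec (S i) n),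
      (Nat.eqb_spec (S i) (S n)), y, k; lia.
Qed.

(** * Elements of the torsion subgroups *)

Lemma geq_app_l R w u v : geq R u v -> geq R (w ++ u) (w ++ v).
Proof.
  induction 1 as [|? ? _ IH|? ? ? _ IH1 _ IH2|? ? x|? ? r Hr].
  - constructor.
  - now apply geq_sym.
  - eapply geq_trans; eassumption.
  - rewrite !app_assoc; apply geq_cancel.
  - rewrite !(app_assoc w); now apply geq_rel.
Qed.

Lemma geq_inv_word R w v : geq R (w ++ inv_word w ++ v) v.
Proof.
  revert v; induction w as [|x w IH]; intro v; [apply geq_refl|].
  rewrite inv_word_cons, <- app_assoc; cbn [app].
  eapply geq_trans; [apply (geq_app_l R [x]), IH|].
  apply (geq_cancel R [] v x).
Qed.

Lemma Tor_root R n w m : 0 < m -> Tor R n (wpow w m) -> Tor R (S n) w.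
Proof.
  intros Hm H.
  replace w with ([] ++ w ++ inv_word []) by apply app_nil_r.
  apply ncl_conj; eauto.
Qed.

Lemma Tor_root_inv R n w m : 0 < m -> Tor R n (wpow w m) -> Tor R (S n) (inv_word w).
Proof.
  intros Hm H.
  replace (inv_word w) with ([] ++ inv_word w ++ inv_word []) by apply app_nil_r.
  apply ncl_conj_inv; eauto.
Qed.

(** By induction x_n and y_n have squares in Tor_n, so both lie in Tor_(n+1), and with them y_n
    x_n^-1, which is the square of the next generator. *)
Lemma gen_word_square_Tor n y : Tor tower n (wpow (gen_word n y) 2).
Proof.
  revert y; induction n as [|n IH]; intro y; cbn [wpow]; rewrite app_nil_r.
  - rewrite <- (app_nil_r (_ ++ _)).
    apply (geq_rel tower [] []); left; eauto.
  - set (x := gen_word n false); set (x' := gen_word n true).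
    apply ncl_eq with (x' ++ inv_word x).
    + apply geq_trans with (square_relator n y ++ x' ++ inv_word x).
      * apply geq_sym, (geq_rel tower []); right; eauto.
      * unfold square_relator; fold x x'; rewrite <- !app_assoc.
        apply geq_app_l.
        rewrite <- (app_nil_r (gen_word (S n) y)) at 2; apply geq_app_l.
        eapply geq_trans.
        -- apply geq_app_l.
           rewrite <- (inv_word_involutive x') at 2; apply geq_inv_word.
        -- rewrite <- (app_nil_r (inv_word x)); apply geq_inv_word.
    + apply ncl_mul; [apply (Tor_root tower n x' 2)|apply (Tor_root_inv tower n x 2)];
        auto; apply IH.
Qed.

Lemma tower_TorLen_infinite : TorLen_infinite tower.
Proof.
  intros n H.
  assert (T : Tor tower n (gen_word n false)).
  { apply H; exists (S n); apply Tor_root with 2; [lia|apply gen_word_square_Tor]. }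
  apply Tor_fixes_from in T; [|exact tower_act].
  (* Inner position -1 is where the commutator is concentrated; at level [n] the half-turn there
     sends v = 0 to 1. *)
  specialize (T (Point 0 (-1) n true 0) (le_n _)).
  rewrite act_gen_word in T; cbn [Z.eqb Pos.eqb andb] in T.
  unfold gen_val in T; rewrite Nat.eqb_refl in T; discriminate.
Qed.

(** * Recursive functions *)

Scheme rf_mut := Induction for rf Sort Prop
  with rfs_mut := Induction for rfs Sort Prop.

(** Serves to turn a halting search back into an actual zero of the searched function. *)
Lemma evalf_functional p : forall v y y', evalf p v y -> evalf p v y' -> y = y'.
Proof.
  induction p as [| |i|f IHf gs IHgs|f IHf g IHg|f IHf| |g IHg gs IHgs] using rf_mut
    with (P0 := fun gs => forall v ys ys', evals gs v ys -> evals gs v ys' -> ys = ys').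
  - inversion 1; inversion 1; congruence.
  - inversion 1; inversion 1; congruence.
  - inversion 1; inversion 1; congruence.
  - inversion 1; inversion 1; subst.
    match goal with H : evals gs v ?a, H' : evals gs v ?b |- _ =>
      assert (a = b) as -> by eauto end; eauto.
  - intros [|n v]; [inversion 1|].
    induction n as [|n IHn]; inversion 1; inversion 1; subst; [eauto|].
    match goal with H : evalf (PrimF f g) (n :: v) ?a, H' : evalf (PrimF f g) (n :: v) ?b |- _ =>
      assert (a = b) as -> by eauto end; eauto.
  - intros v n n' H H'; inversion_clear H as [| | | | | |? ? ? H0 Hlt];
      inversion_clear H' as [| | | | | |? ? ? H0' Hlt'].
    destruct (Nat.lt_trichotomy n n') as [L|[L|L]]; [|exact L|]; exfalso.
    + destruct (Hlt' _ L) as [k Hk]; discriminate (IHf _ _ _ H0 Hk).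
    + destruct (Hlt _ L) as [k Hk]; discriminate (IHf _ _ _ H0' Hk).
  - inversion 1; inversion 1; congruence.
  - inversion 1; inversion 1; subst; f_equal; eauto.
Qed.

Definition computable1 (f : nat -> nat) : Prop :=
  exists p, forall n, evalf p [n] (f n).
Definition computable2 (f : nat -> nat -> nat) : Prop :=
  exists p, forall n m, evalf p [n; m] (f n m).

Lemma computable1_ext f g : (forall n, f n = g n) -> computable1 f -> computable1 g.
Proof. intros E [p H]; exists p; intro n; rewrite <- E; apply H. Qed.

Lemma computable1_id : computable1 (fun n => n).
Proof. exists (ProjF 0); intro n; apply (ev_proj 0 [n]); cbn; lia. Qed.

Lemma computable2_fst : computable2 (fun n _ => n).
Proof. exists (ProjF 0); intros n m; apply (ev_proj 0 [n; m]); cbn; lia. Qed.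

Lemma computable2_snd : computable2 (fun _ m => m).
Proof. exists (ProjF 1); intros n m; apply (ev_proj 1 [n; m]); cbn; lia. Qed.

Lemma computable1_succ : computable1 S.
Proof. exists SuccF; intro n; apply ev_succ. Qed.

Lemma computable1_comp f g :
  computable1 f -> computable1 g -> computable1 (fun n => f (g n)).
Proof.
  intros [p Hp] [q Hq]; exists (CompF p (RCons q RNil)); intro n.
  econstructor; [repeat econstructor|]; eauto.
Qed.

Lemma computable2_comp1 f g :
  computable1 f -> computable2 g -> computable2 (fun n m => f (g n m)).
Proof.
  intros [p Hp] [q Hq]; exists (CompF p (RCons q RNil)); intros n m.
  econstructor; [repeat econstructor|]; eauto.
Qed.

Lemma computable1_comp2 f g h :
  computable2 f -> computable1 g -> computable1 h -> computable1 (fun n => f (g n) (h n)).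
Proof.
  intros [p Hp] [q Hq] [r Hr]; exists (CompF p (RCons q (RCons r RNil))); intro n.
  econstructor; [repeat econstructor|]; eauto.
Qed.

Lemma computable2_comp2 f g h :
  computable2 f -> computable2 g -> computable2 h ->
  computable2 (fun n m => f (g n m) (h n m)).
Proof.
  intros [p Hp] [q Hq] [r Hr]; exists (CompF p (RCons q (RCons r RNil))); intros n m.
  econstructor; [repeat econstructor|]; eauto.
Qed.

Lemma computable1_const c : computable1 (fun _ => c).
Proof.
  induction c as [|c IH].
  - exists ZeroF; intro; constructor.
  - exact (computable1_comp _ _ computable1_succ IH).
Qed.

Lemma computable1_rec f g :
  computable2 g -> f 0 = 0 -> (forall n, f (S n) = g n (f n)) -> computable1 f.
Proof.
  intros [q Hq] E0 ES; exists (PrimF ZeroF q); intro n.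
  induction n as [|n IH].
  - rewrite E0; repeat constructor.
  - rewrite ES; econstructor; eauto.
Qed.

Lemma computable2_rec f g h :
  computable1 h -> computable2 g ->
  (forall m, f 0 m = h m) -> (forall n m, f (S n) m = g (f n m) m) -> computable2 f.
Proof.
  intros [p Hp] [q Hq] E0 ES.
  (* The step function of [PrimF] receives the counter, the previous value and the parameter; the
     projections drop the counter. *)
  exists (PrimF p (CompF q (RCons (ProjF 1) (RCons (ProjF 2) RNil)))); intros n m.
  induction n as [|n IH].
  - rewrite E0; constructor; auto.
  - rewrite ES; econstructor; [exact IH|].
    econstructor; [|apply Hq].
    constructor; [apply (ev_proj 1 [n; f n m; m]); cbn; lia|].
    constructor; [apply (ev_proj 2 [n; f n m; m]); cbn; lia|constructor].
Qed.

Lemma computable2_add : computable2 Nat.add.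
Proof.
  apply computable2_rec with (g := fun r _ => S r) (h := fun m => m); try reflexivity.
  - apply computable1_id.
  - apply computable2_comp1 with (f := S); [apply computable1_succ|apply computable2_fst].
Qed.

Lemma computable2_mul : computable2 Nat.mul.
Proof.
  apply computable2_rec with (g := fun r m => m + r) (h := fun _ => 0); try reflexivity.
  - apply computable1_const.
  - apply computable2_comp2 with (f := Nat.add);
      [apply computable2_add|apply computable2_snd|apply computable2_fst].
Qed.

Lemma computable1_pred : computable1 Nat.pred.
Proof. apply computable1_rec with (g := fun n _ => n); auto using computable2_fst. Qed.

(** The arguments are reversed because the recursion runs on the first one: it takes [n]
    predecessors of [m]. *)
Lemma computable2_sub : computable2 (fun n m => m - n).
Proof.
  apply computable2_rec with (g := fun r _ => Nat.pred r) (h := fun m => m).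
  - apply computable1_id.
  - apply computable2_comp1 with (f := Nat.pred);
      [apply computable1_pred|apply computable2_fst].
  - intro; lia.
  - intros; lia.
Qed.

Definition dist (n m : nat) : nat := (m - n) + (n - m).

Lemma dist_eq0 n m : dist n m = 0 <-> n = m.
Proof. unfold dist; lia. Qed.

Lemma computable2_dist f : computable1 f -> computable2 (fun n m => dist (f n) m).
Proof.
  intro Hf; unfold dist.
  assert (C : computable2 (fun n _ => f n))
    by (apply computable2_comp1; auto using computable2_fst).
  apply computable2_comp2 with (f := Nat.add); [apply computable2_add| |].
  - apply (computable2_comp2 (fun n m => m - n)); auto using computable2_sub, computable2_snd.
  - apply (computable2_comp2 (fun n m => m - n)); auto using computable2_sub, computable2_snd.
Qed.

Lemma re_nat_search D (A : nat -> Prop) :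
  computable2 D -> (forall x, A x <-> exists n, D n x = 0) -> re_nat A.
Proof.
  intros [p Hp] E; exists (MuF p); intro x; rewrite E; split.
  - intros [n Hn].
    induction n as [n IH] using lt_wf_ind.
    (* A bounded search decides whether a smaller zero exists; if not, [n] is the least zero, as
       [MuF] demands. *)
    destruct (existsb (fun m => Nat.eqb (D m x) 0) (seq 0 n)) eqn:Ex.
    + apply existsb_exists in Ex; destruct Ex as (m & Hm & Hm0).
      apply in_seq in Hm; apply Nat.eqb_eq in Hm0; apply (IH m); [lia|exact Hm0].
    + exists n; constructor; [rewrite <- Hn; apply Hp|].
      intros m Hm.
      destruct (D m x) as [|k] eqn:Dm; [|exists k; rewrite <- Dm; apply Hp].
      assert (existsb (fun m => Nat.eqb (D m x) 0) (seq 0 n) = true); [|congruence].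
      apply existsb_exists; exists m; rewrite in_seq, Dm; split; [lia|reflexivity].
  - intros [n Hn]; inversion_clear Hn as [| | | | | |? ? ? H0 _].
    exists n; exact (evalf_functional _ _ _ _ (Hp n x) H0).
Qed.

Definition range (f : nat -> nat) (k : nat) : Prop := exists n, f n = k.

(** A single search handles all four ranges, since a product of distances vanishes iff some factor
    does. *)
Lemma re_nat_ranges f0 f1 f2 f3 A :
  computable1 f0 -> computable1 f1 -> computable1 f2 -> computable1 f3 ->
  (forall k, A k <-> range f0 k \/ range f1 k \/ range f2 k \/ range f3 k) -> re_nat A.
Proof.
  intros C0 C1 C2 C3 HA.
  apply re_nat_search with
    (D := fun n m => dist (f0 n) m * (dist (f1 n) m * (dist (f2 n) m * dist (f3 n) m))).
  - repeat (apply (computable2_comp2 Nat.mul);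
      [apply computable2_mul|apply computable2_dist; assumption|]).
    now apply computable2_dist.
  - intro k; rewrite HA; unfold range; split.
    + intros [[n H]|[[n H]|[[n H]|[n H]]]]; exists n;
        apply dist_eq0 in H; rewrite !Nat.mul_eq_0; tauto.
    + intros [n H]; rewrite !Nat.mul_eq_0, !dist_eq0 in H.
      destruct H as [H|[H|[H|H]]]; eauto.
Qed.

(** * Computable families of words *)

(* The second clause makes the notion stable under concatenation, as
   [code_word (u ++ v) = code_word u + 5 ^ length u * code_word v]. *)
Definition computable_words (W : nat -> word) : Prop :=
  computable1 (fun n => code_word (W n)) /\ computable1 (fun n => 5 ^ length (W n)).

Lemma code_word_app u v : code_word (u ++ v) = code_word u + 5 ^ length u * code_word v.
Proof.
  induction u as [|x u IH]; [cbn; lia|].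
  cbn [app code_word length]; rewrite IH, Nat.pow_succ_r'; lia.
Qed.

Lemma computable_words_app U V :
  computable_words U -> computable_words V -> computable_words (fun n => U n ++ V n).
Proof.
  intros [CU LU] [CV LV]; split.
  - apply computable1_ext with
      (fun n => code_word (U n) + 5 ^ length (U n) * code_word (V n)).
    { intro; now rewrite code_word_app. }
    apply (computable1_comp2 Nat.add); [apply computable2_add|assumption|].
    now apply (computable1_comp2 Nat.mul); [apply computable2_mul| |].
  - apply computable1_ext with (fun n => 5 ^ length (U n) * 5 ^ length (V n)).
    { intro; now rewrite length_app, Nat.pow_add_r. }
    now apply (computable1_comp2 Nat.mul); [apply computable2_mul| |].
Qed.

Lemma computable1_affine c d : computable1 (fun n => c * n + d).
Proof.
  apply (computable1_comp2 Nat.add); [apply computable2_add| |apply computable1_const].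
  apply (computable1_comp2 Nat.mul);
    [apply computable2_mul|apply computable1_const|apply computable1_id].
Qed.

Lemma computable_words_const w : computable_words (fun _ => w).
Proof. split; apply computable1_const. Qed.

Lemma code_word_repeat_computable x : computable1 (fun n => code_word (repeat x n)).
Proof.
  apply computable1_rec with (g := fun _ r => 5 * r + S (code_letter x)).
  - apply (computable2_comp1 (fun r => 5 * r + S (code_letter x)));
      [apply computable1_affine|apply computable2_snd].
  - reflexivity.
  - intro n; cbn [repeat code_word]; lia.
Qed.

(* [computable1_rec] starts at [0], so the recursion computes [5 ^ n - 1]. *)
Lemma computable1_pow5 : computable1 (fun n => 5 ^ n).
Proof.
  apply computable1_ext with (fun n => S (5 ^ n - 1)).
  { intro n; pose proof (Nat.pow_nonzero 5 n); lia. }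
  apply (computable1_comp S); [apply computable1_succ|].
  apply computable1_rec with (g := fun _ r => 5 * r + 4).
  - apply (computable2_comp1 (fun r => 5 * r + 4));
      [apply computable1_affine|apply computable2_snd].
  - reflexivity.
  - intro n; rewrite Nat.pow_succ_r'; pose proof (Nat.pow_nonzero 5 n); lia.
Qed.

Lemma computable_words_repeat x f :
  computable1 f -> computable_words (fun n => repeat x (f n)).
Proof.
  intro Hf; split.
  - apply (computable1_comp (fun n => code_word (repeat x n)));
      [apply code_word_repeat_computable|assumption].
  - apply computable1_ext with (fun n => 5 ^ f n).
    { intro; now rewrite repeat_length. }
    now apply (computable1_comp (fun n => 5 ^ n)); [apply computable1_pow5|].
Qed.

Lemma computable_words_gen_word f y :
  computable1 f -> computable_words (fun n => gen_word (f n) y).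
Proof.
  intro Hf; unfold gen_word, position.
  assert (computable1 (fun n => 4 * f n + (if y then 3 else 1)))
    by (apply (computable1_comp (fun n => 4 * n + (if y then 3 else 1)));
        [apply computable1_affine|assumption]).
  repeat first [apply computable_words_app | apply computable_words_const
               | apply computable_words_repeat; assumption].
Qed.

Lemma computable_words_inv_gen_word y : computable_words (fun n => inv_word (gen_word n y)).
Proof.
  (* Spelled out, the inverse is again a concatenation of constants and [repeat] blocks, to which
     the closure lemmas apply. *)
  assert (E : forall n, inv_word (gen_word n y) =
    let s := position n y in
    repeat lb s ++ [la] ++ repeat lB s ++ [la] ++ repeat lb s ++ [lA] ++ repeat lB s ++ [lA]).
  { intro n; unfold gen_word; cbv zeta.
    rewrite !inv_word_app, !inv_word_repeat, <- !app_assoc; reflexivity. }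
  assert (C : computable_words (fun n => let s := position n y in
    repeat lb s ++ [la] ++ repeat lB s ++ [la] ++ repeat lb s ++ [lA] ++ repeat lB s ++ [lA])).
  { cbv zeta; unfold position.
    pose proof (computable1_affine 4 (if y then 3 else 1)).
    repeat first [apply computable_words_app | apply computable_words_const
                 | apply computable_words_repeat; assumption]. }
  destruct C as [C L]; split;
    [eapply computable1_ext, C|eapply computable1_ext, L]; intro n; now rewrite E.
Qed.

Lemma computable_words_square_relator y : computable_words (fun n => square_relator n y).
Proof.
  unfold square_relator.
  do 3 (apply computable_words_app;
    [apply computable_words_gen_word; auto using computable1_succ, computable1_id|]).
  apply computable_words_inv_gen_word.
Qed.

Lemma tower_re : re_words tower.
Proof.
  (* The two relators at the bottom of the tower enter as constant families. *)
  assert (B : forall y, computable1 (fun _ => code_word (gen_word 0 y ++ gen_word 0 y)))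
    by (intro; apply computable1_const).
  refine (re_nat_ranges _ _ _ _ _ (B false) (B true)
    (proj1 (computable_words_square_relator false))
    (proj1 (computable_words_square_relator true)) _).
  intro k; unfold range, tower; split.
  - intros (w & [[[|] ->]|(n & [|] & ->)] & <-).
    + right; left; now exists 0.
    + left; now exists 0.
    + right; right; right; now exists n.
    + right; right; left; now exists n.
  - intros [[_ <-]|[[_ <-]|[[n <-]|[n <-]]]];
      eexists; (split; [|reflexivity]); [left|left|right|right]; eauto.
Qed.

Theorem theorem6p3 :
  exists R : relators, re_words R /\ TorLen_infinite R.
Proof. exists tower; split; [exact tower_re|exact tower_TorLen_infinite]. Qed.
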